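(* Let $\lambda$ be an infinite cardinal. Suppose that $X$ is a product of nonempty topological spaces and that all factors but at most one are GO spaces. Then the following hold. (1) $X$ is initially $\lambda$-compact if and only if each factor is initially $\lambda$-compact. (2) $X$ is weakly initially $\lambda$-compact if and only if each factor is weakly initially $\lambda$-compact.
   Context: A GO space (generalized ordered topological space) is a linearly ordered set with a Hausdorff topology having a base of order-convex sets. Products (of arbitrarily many factors) carry the Tychonoff product topology. A topological space is initially $\lambda$-compact if every open cover of cardinality $\leq\lambda$ has a finite subcover. It is weakly initially $\lambda$-compact if every open cover of cardinality $\leq\lambda$ has a finite subfamily with dense union. *)

(* Defs.v *)
From HB Require Import structures.
From mathcomp Require Import all_boot all_order.
From mathcomp Require Import all_classical wochoice.
From mathcomp Require Import topology.

Set Implicit Arguments.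
Unset Strict Implicit.
Unset Printing Implicit Defensive.

Local Open Scope classical_set_scope.
Local Open Scope card_scope.

Definition order_convex (T : Type) (le : rel T) (A : set T) : Prop :=
  forall x y z : T, A x -> A z -> le x y -> le y z -> A y.

(* The linear order is not part of the data of a factor, so a topological
   space is GO when some linear order on its carrier makes it so. *)
Definition GO_space (T : topologicalType) : Prop :=
  exists le : rel T,
    [/\ total_order le,
        hausdorff_space T &
        exists2 B : set (set T), basis B & B `<=` order_convex le].

(* A cardinal is given by a type L of that cardinality. *)
Definition open_cover_le (L : Type) (T : topologicalType) (C : set (set T)) :
    Prop :=
  [/\ C `<=` open, cover C id = [set: T] & C #<= [set: L]].

Definition initially_compact (L : Type) (T : topologicalType) : Prop :=
  forall C : set (set T), open_cover_le L C ->
    exists D : set (set T),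
      [/\ D `<=` C, finite_set D & cover D id = [set: T]].

Definition weakly_initially_compact (L : Type) (T : topologicalType) : Prop :=
  forall C : set (set T), open_cover_le L C ->
    exists D : set (set T),
      [/\ D `<=` C, finite_set D & dense (cover D id)].

(* Main.v *)
Require Import Defs.
From HB Require Import structures.
From mathcomp Require Import all_boot all_order.
From mathcomp Require Import all_classical.
From mathcomp Require Import topology.

(** Call a space T ultra-bounded when every ultrafilter on T that contains a
    set of cardinality at most |L| converges.  Three facts about this property
    give both parts at once.

    A weakly initially |L|-compact GO space is ultra-bounded
    ([GO_ultra_bounded]).  An ultrafilter F on a linear order determines a cut
    (Lo, Hi).  Suppose that F lives on Lo, contains A with |A| <= |L|, and has
    no limit.  Then A is cofinal in Lo, and both Lo and Hi are open, since a
    point of Hi that Lo accumulates at would be a limit of F.  The sets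
    ]-oo, a[ `|` Hi, for a in A `&` Lo, then form a cover with at most |L|
    members, and every finite union of them misses a nonempty open final piece
    of Lo.  So for GO spaces the weak and the strong compactness agree.

    Products of ultra-bounded spaces are ultra-bounded
    ([ultra_bounded_prod]), by convergence in each coordinate.

    If Y is ultra-bounded and Z is (weakly) initially |L|-compact, so is Y * Z
    ([compact_for_prod]).  Given a cover C without the required finite
    subfamily, choose for each finite D included in C a point y_D and a
    nonempty set W_D in Z, open in the weak case, such that {y_D} * W_D misses
    the union of D.  Compactness of Z gives a point z that the sets W_D
    accumulate at cofinally in D; the points y_D with W_D close to z generate a
    filter on Y, and an ultrafilter finer than it converges to some y.  The
    member of C around (y, z) then meets some {y_D} * W_D with D containing
    it, which is absurd.  This uses |L| indices D, hence the cardinal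
    arithmetic of the first part: an infinite set has no more finite subsets
    than elements.

    Since [prod_topology X] is a continuous image of the product of its GO
    factors, which is ultra-bounded, with the one exceptional factor, this
    gives one direction; the other holds because each factor is a continuous
    image of the product.  Weak and strong compactness are treated together by
    [compact_for L Q], where Q is the class of sets that a finite subfamily of
    the cover has to meet. *)

Set Implicit Arguments.
Unset Strict Implicit.
Unset Printing Implicit Defensive.

Local Open Scope classical_set_scope.
Local Open Scope card_scope.

(** * Finite subsets of an infinite set *)

Lemma card_le_fun (T U : Type) (A : set T) (B : set U) (b : U) :
  A #<= B ->
  exists f : T -> U, (forall x, A x -> B (f x)) /\
    (forall x y, A x -> A y -> f x = f y -> x = y).
Proof.
elim/Ppointed: U => U in B b *; first by case: (no b).
move=> /pcard_leP/injfunPex[f fAB fI]; exists f; split=> // x y Ax Ay.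
by apply: fI; exact: mem_set.
Qed.

Lemma fun_card_le (T U : Type) (A : set T) (B : set U) (f : T -> U) :
  (forall x, A x -> B (f x)) ->
  (forall x y, A x -> A y -> f x = f y -> x = y) -> A #<= B.
Proof.
move=> fAB fI; have : $|{injfun A >-> B}|.
  by apply/injfunPex; exists f => // x y /set_mem Ax /set_mem Ay; exact: fI.
by move=> [g]; exact: inj_card_le.
Qed.

(** Comparability of cardinals: a maximal partial bijection between A and B
    exhausts A or B, as otherwise one more pair could be added. *)
Lemma card_le_total (T U : Type) (A : set T) (B : set U) :
  A #<= B \/ B #<= A.
Proof.
have [->|/set0P[a _]] := eqVneq A set0; first by left; exact: card_ge0.
have [->|/set0P[b _]] := eqVneq B set0; first by right; exact: card_ge0.
pose partial_bij (G : set (T * U)) :=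
  (forall p, G p -> A p.1 /\ B p.2) /\
  (forall p q, G p -> G q -> (p.1 = q.1 <-> p.2 = q.2)).
have [F Fpb Ftot|G [[GAB Gbij] Gmax]] := @Zorn_bigcup _ partial_bij.
  split=> [p [G FG Gp]|p q [G FG Gp] [H FH Hq]]; first exact: (Fpb G FG).1.
  have [GH|HG] := Ftot _ _ FG FH.
    by apply: (Fpb H FH).2 => //; exact: GH.
  by apply: (Fpb G FG).2 => //; exact: HG.
have [Atot|] := pselect (forall x, A x -> exists y, G (x, y)).
  left; have /choice[f fP] : forall x, exists y, A x -> G (x, y).
    by move=> x; have [/Atot[y]|] := pselect (A x); [exists y|exists b].
  apply: (@fun_card_le _ _ _ _ f) => [x /fP/GAB[]//|x y /fP Gx /fP Gy fxy].
  exact: (Gbij _ _ Gx Gy).2.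
move=> /existsNP[x0 /not_implyP[Ax0 /forallNP nGx0]].
have [Btot|] := pselect (forall y, B y -> exists x, G (x, y)).
  right; have /choice[g gP] : forall y, exists x, B y -> G (x, y).
    by move=> y; have [/Btot[x]|] := pselect (B y); [exists x|exists a].
  apply: (@fun_card_le _ _ _ _ g) => [y /gP/GAB[]//|x y /gP Gx /gP Gy gxy].
  exact: (Gbij _ _ Gx Gy).1.
move=> /existsNP[y0 /not_implyP[By0 /forallNP nGy0]].
exfalso; apply: (Gmax (G `|` [set (x0, y0)])).
  split=> [p|/(_ (x0, y0))]; first by left.
  by move=> /(_ (or_intror erefl)); exact: nGx0.
split=> [p [/GAB//|->//]|p q].
have fresh p' : G p' -> p'.1 <> x0 /\ p'.2 <> y0.
  by case: p' => x y /= Gxy; split=> e; [apply: (nGx0 y)|apply: (nGy0 x)];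
    rewrite -e.
move=> [Gp|->] [Gq|->] //=; first exact: Gbij.
  by have [? ?] := fresh p Gp; split.
by have [n1 n2] := fresh q Gq; split=> e; [case: n1|case: n2].
Qed.

Section square.
Variable L : Type.

(** A triple (x, y, z) in G records that z is a code of the pair (x, y); codes
    are relational, and possibly several per pair, so that unions of chains need
    no gluing of functions.  [diag G] is the set on which G codes pairs. *)
Definition diag (G : set (L * L * L)) : set L := [set x | exists z, G (x, x, z)].

Definition square_coding (G : set (L * L * L)) :=
  [/\ forall p q z, G (p, z) -> G (q, z) -> p = q,
      forall x y z, G (x, y, z) -> [/\ diag G x, diag G y & diag G z] &
      forall x y, diag G x -> diag G y -> exists z, G (x, y, z)].

Lemma diagS (G H : set (L * L * L)) : G `<=` H -> diag G `<=` diag H.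
Proof. by move=> GH x [z /GH Hz]; exists z. Qed.

Lemma bigcup_square_coding (F : set (set (L * L * L))) :
  F `<=` square_coding -> total_on F subset ->
  square_coding (\bigcup_(G in F) G).
Proof.
move=> Fcod Ftot; split.
- move=> p q z [G FG Gz] [H FH Hz]; have [GH|HG] := Ftot _ _ FG FH.
    by have [Hinj _ _] := Fcod H FH; exact: Hinj (GH _ Gz) Hz.
  by have [Ginj _ _] := Fcod G FG; exact: Ginj Gz (HG _ Hz).
- move=> x y z [G FG Gxyz].
  have [_ /(_ _ _ _ Gxyz)[dx dy dz] _] := Fcod G FG.
  by split; apply: (diagS (bigcup_sup FG)).
- move=> x y [z1 [G FG Gx]] [z2 [H FH Hy]]; have [GH|HG] := Ftot _ _ FG FH.
    have [_ _ /(_ x y)[||z Hz]] := Fcod H FH; last by exists z, H.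
    + by exists z1; apply: GH; exact: Gx.
    + by exists z2.
  have [_ _ /(_ x y)[||z Hz]] := Fcod G FG; last by exists z, G.
  + by exists z1.
  + by exists z2; apply: HG; exact: Hy.
Qed.

Lemma nat_square_coding (i : nat -> L) : injective i ->
  square_coding [set t | exists m n, t = (i m, i n, i (pickle (m, n)))].
Proof.
move=> iI; set G := (X in square_coding X).
have Gi n : diag G (i n) by exists (i (pickle (n, n))), n, n.
split.
- move=> p q z [m [n [-> ->]]] [m' [n' [-> /iI e]]].
  by have [-> ->] := pcan_inj pickleK e.
- by move=> _ _ _ [m [n [-> -> ->]]]; split; exact: Gi.
- move=> x y [_ [m [_ [-> _ _]]]] [_ [n [_ [-> _ _]]]].
  by exists (i (pickle (m, n))), m, n.
Qed.

End square.

(** Zorn's lemma applies above the coding that a copy of nat carries, so the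
    maximal coding lives on an infinite set. *)
Lemma maximal_square_coding (L : Type) (i : nat -> L) : injective i ->
  exists G : set (L * L * L), [/\ square_coding G, forall n, diag G (i n) &
    forall H, square_coding H -> G `<=` H -> H `<=` G].
Proof.
move=> iI; have := nat_square_coding iI.
set N := (X in square_coding X) => Ncod.
(* The empty chain has to be bounded too, whence the union with N. *)
have [F Fcod Ftot|G [Gcod Gmax]] := @Zorn_bigcup _ [set G | square_coding (N `|` G)].
  have [->|/set0P[G0 FG0]] := eqVneq F set0; first by rewrite /= bigcup_set0 setU0.
  rewrite /= (_ : _ `|` _ = \bigcup_(G in [set N `|` G | G in F]) G).
    apply: bigcup_square_coding => [_ [G FG <-]|]; first exact: Fcod.
    move=> _ _ [G FG <-] [H FH <-].
    by have [GH|HG] := Ftot _ _ FG FH; [left|right]; exact: setUS.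
  apply/seteqP; split=> t.
    by move=> [Nt|[G FG Gt]]; [exists (N `|` G0)|exists (N `|` G)];
      [exists G0|left|exists G|right].
  by move=> [_ [G FG <-] [Nt|Gt]]; [left|right; exists G].
exists (N `|` G); split=> // [n|H Hcod NGH].
  by exists (i (pickle (n, n))); left; exists n, n.
apply: contrapT => nHG; apply: (Gmax H).
  split; first by apply: subset_trans NGH; exact: subsetUr.
  by move=> HG; apply: nHG => t /HG; right.
by rewrite /= setUidr//; apply: subset_trans NGH; exact: subsetUl.
Qed.

(** Hessenberg's theorem |L| * |L| <= |L|.  A maximal coding lives on some A with
    |A| * |A| <= |A|, hence |A| + |A| <= |A|.  If L `\` A injects into A,
    then |L| <= |A| + |A| and the coding of A serves for L.  Otherwise A has a
    copy B outside A, and the pairs from A `|` B that are not pairs from A can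
    be coded in B, against maximality. *)
Lemma infinite_square_inj (L : Type) : infinite_set [set: L] ->
  exists p : L -> L -> L,
    forall x y x' y', p x y = p x' y' -> x = x' /\ y = y'.
Proof.
move=> /[dup] /infinite_setN0[l0 _] /infiniteP/(card_le_fun l0)[i [_ iI']].
have iI : injective i by move=> m n; exact: iI'.
have [G [Gcod Gi Gmax]] := maximal_square_coding iI; have [Ginj GA Gtot] := Gcod.
set A := diag G in GA Gtot Gi.
have /choice[j' j'P] : forall xy : L * L, exists z, A xy.1 -> A xy.2 -> G (xy, z).
  move=> [x y] /=; have [Ax|nAx] := pselect (A x); last by exists l0.
  have [Ay|nAy] := pselect (A y); last by exists l0.
  by have [z Gz] := Gtot _ _ Ax Ay; exists z.
pose j x y := j' (x, y).
have jP x y : A x -> A y -> G (x, y, j x y) by move=> Ax Ay; exact: j'P.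
have jA x y : A x -> A y -> A (j x y).
  by move=> Ax Ay; have [] := GA _ _ _ (jP _ _ Ax Ay).
have jI x y x' y' : A x -> A y -> A x' -> A y' -> j x y = j x' y' ->
    x = x' /\ y = y'.
  move=> Ax Ay Ax' Ay' e; have := jP _ _ Ax Ay; rewrite e => Gz.
  by have [-> ->] := Ginj _ _ _ Gz (jP _ _ Ax' Ay').
(* |A| + |A| <= |A|: the first components i 0 and i 1 mark the two summands. *)
have absorb (S : set L) : (S `\` A) #<= A -> exists e : L -> L,
    (forall x, S x -> A (e x)) /\
    (forall x y, S x -> S y -> e x = e y -> x = y).
  move=> /(card_le_fun l0)[k [kA kI]].
  exists (fun x => if pselect (A x) then j (i 0%N) x else j (i 1%N) (k x)).
  split=> [x Sx|x y Sx Sy].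
    by case: pselect => Ax; apply: jA => //; exact: kA.
  case: pselect => Ax; case: pselect => Ay e.
  - by have [] := jI _ _ _ _ (Gi _) Ax (Gi _) Ay e.
  - have [/iI//] := jI _ _ _ _ (Gi _) Ax (Gi _) (kA _ (conj Sy Ay)) e.
  - have [/iI//] := jI _ _ _ _ (Gi _) (kA _ (conj Sx Ax)) (Gi _) Ay e.
  have [_ kxy] := jI _ _ _ _ (Gi _) (kA _ (conj Sx Ax)) (Gi _) (kA _ (conj Sy Ay)) e.
  exact: kI kxy.
have [|] := card_le_total (~` A) A.
  rewrite -setTD => /absorb[e [eA eI]]; exists (fun x y => j (e x) (e y)) => x y x' y' exy.
  by have [/eI-> // /eI->] := jI _ _ _ _ (eA x I) (eA y I) (eA x' I) (eA y' I) exy.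
move=> /(card_le_fun l0)[h [hA hI]]; exfalso.
set B := h @` A.
have BA x : B x -> ~ A x by move=> [a Aa <-]; exact: hA.
have [|e [eA eI]] := absorb (A `|` B).
  apply: card_le_trans (card_image_le h A); apply: subset_card_le => x [[]//].
pose H := G `|` [set t | [/\ (A `|` B) t.1.1, (A `|` B) t.1.2,
  ~ (A t.1.1 /\ A t.1.2) & t.2 = h (j (e t.1.1) (e t.1.2))]].
have ABdiag x : (A `|` B) x -> diag H x.
  move=> [[z Gz]|Bx]; first by exists z; left.
  exists (h (j (e x) (e x))); right; split=> /=; [by right|by right| |by []].
  by move=> [/(BA _ Bx)].
have diagAB x : diag H x -> (A `|` B) x.
  by move=> [z [Gz|[]//]]; left; exists z.
have hj x y : (A `|` B) x -> (A `|` B) y -> B (h (j (e x) (e y))).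
  by move=> ABx ABy; exists (j (e x) (e y)) => //; apply: jA; exact: eA.
have GB p z : G (p, z) -> ~ B z.
  by case: p => x y /GA[_ _ Az] /BA.
have Hcod : square_coding H.
  split.
  - move=> [x y] [x' y'] z [Gz|[/= ABx ABy _ ez]] [Gz'|[/= ABx' ABy' _ ez']].
    + exact: Ginj Gz Gz'.
    + by case: (GB _ _ Gz); rewrite ez'; exact: hj.
    + by case: (GB _ _ Gz'); rewrite ez; exact: hj.
    + have /hI e1 : h (j (e x) (e y)) = h (j (e x') (e y')) by rewrite -ez.
      have [] := jI _ _ _ _ (eA _ ABx) (eA _ ABy) (eA _ ABx') (eA _ ABy').
        by apply: e1; apply: jA; exact: eA.
      by move=> /eI-> // /eI->.
  - move=> x y z [/GA[Ax Ay Az]|[/= ABx ABy _ ->]].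
      by split; apply: ABdiag; left.
    by split; apply: ABdiag => //; right; exact: hj.
  - move=> x y /diagAB ABx /diagAB ABy.
    have [[Ax Ay]|nA] := pselect (A x /\ A y).
      by have [z Gz] := Gtot _ _ Ax Ay; exists z; left.
    by exists (h (j (e x) (e y))); right.
have Bb : B (h (i 0%N)) by exists (i 0%N).
have [z Hz] := ABdiag _ (or_intror Bb).
by apply: (BA _ Bb); exists z; apply: (Gmax H) => //; exact: subsetUl.
Qed.

(** Iterated pairing is injective on sequences of a given length; pairing with
    the length makes it injective on all of them. *)
Lemma infinite_seq_inj (L : Type) : infinite_set [set: L] ->
  exists c : seq L -> L, injective c.
Proof.
move=> Linf; have [p pI] := infinite_square_inj Linf.
have [l0 _] := infinite_setN0 Linf.
have /infiniteP/(card_le_fun l0)[i [_ iI]] := Linf.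
exists (fun s => p (i (size s)) (foldr p l0 s)) => s t /pI[/(iI _ _ I I)].
elim: s t => [|x s IH] [|y t] //= [st] /pI[-> /(IH _ st)->//].
Qed.

Lemma card_le_finite_subsets (L T : Type) (C : set T) :
  infinite_set [set: L] -> C #<= [set: L] ->
  [set D | finite_set D /\ D `<=` C] #<= [set: L].
Proof.
move=> Linf; have [l0 _] := infinite_setN0 Linf.
have [c cI] := infinite_seq_inj Linf.
move=> /(card_le_fun l0)[f [_ fI]].
have /choice[s sP] : forall D : set T, exists s : seq {classic L},
    finite_set D -> f @` D = [set` s].
  move=> D; have [Dfin|] := pselect (finite_set D); last by exists [::].
  have /finite_seqP[s sE] : finite_set (f @` D : set {classic L}).
    exact: finite_image.
  by exists s.
apply: (@fun_card_le _ _ _ _ (c \o s)) => // D E [Dfin DC] [Efin EC] /= /cI sDE.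
have fDE : f @` D = f @` E by rewrite (sP D Dfin) (sP E Efin) sDE.
have sub D' E' : D' `<=` C -> E' `<=` C -> f @` D' = f @` E' -> D' `<=` E'.
  move=> D'C E'C fDE' x D'x.
  have [y E'y] : (f @` E') (f x) by rewrite -fDE'; exists x.
  by move=> /fI <-//; [exact: E'C|exact: D'C].
by apply/seteqP; split; apply: sub.
Qed.

(** * Compactness relative to a class of test sets *)

(** With Q the class of all sets this is initial compactness, as Q contains the
    singletons; with Q the class of open sets it is the weak form, as meeting
    every nonempty open set is density. *)
Definition compact_for (L : Type) (T : topologicalType) (Q : set (set T)) :=
  forall C : set (set T), open_cover_le L C ->
    exists D, [/\ D `<=` C, finite_set D &
      forall W, Q W -> W !=set0 -> W `&` cover D id !=set0].

Lemma initially_compactE (L : Type) (T : topologicalType) :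
  initially_compact L T <-> compact_for L [set: set T].
Proof.
split=> cT C /cT[D [DC Dfin Dcov]]; exists D; split=> //.
  by rewrite Dcov => W _ [x Wx]; exists x.
apply/seteqP; split=> // x _.
by have [] := Dcov [set x] I (ex_intro _ x erefl); move=> _ [->].
Qed.

Lemma weakly_initially_compactE (L : Type) (T : topologicalType) :
  weakly_initially_compact L T <-> compact_for L (@open T).
Proof.
by split=> cT C /cT[D [DC Dfin Dd]]; exists D; split=> // W;
  [move=> oW W0|move=> W0 oW]; exact: Dd.
Qed.

Lemma compact_forS (L : Type) (T : topologicalType) (Q P : set (set T)) :
  P `<=` Q -> compact_for L Q -> compact_for L P.
Proof.
move=> PQ cT C /cT[D [DC Dfin Dmeet]]; exists D; split=> // W /PQ.
exact: Dmeet.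
Qed.

Lemma compact_for_image (L : Type) (S T : topologicalType) (f : S -> T)
    (P : set (set S)) (Q : set (set T)) :
  continuous f -> (forall t, exists s, f s = t) ->
  (forall W, Q W -> P (f @^-1` W)) ->
  compact_for L P -> compact_for L Q.
Proof.
move=> /continuousP fcont fsurj QP cS C [Copen Ccov CL].
have [|D [DC Dfin Dmeet]] := cS (preimage f @` C).
  split=> [_ [U CU <-]||]; first exact/fcont/Copen.
    apply/seteqP; split=> // s _; have : cover C id (f s) by rewrite Ccov.
    by move=> [U CU Ufs]; exists (f @^-1` U) => //; exists U.
  exact: card_le_trans (card_image_le _ _) CL.
have /choice[g gP] : forall A, exists U, D A -> C U /\ f @^-1` U = A.
  move=> A; have [/DC[U CU UA]|] := pselect (D A); first by exists U.
  by exists set0.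
exists (g @` D); split=> [_ [A /gP[CgA _] <-]//||W QW [t Wt]].
  exact: finite_image.
have [s fst] := fsurj t.
have [|x [Wfx [A DA Ax]]] := Dmeet _ (QP W QW); first by exists s; rewrite /= fst.
exists (f x); split=> //; exists (g A); first by exists A.
by have [_ gA] := gP A DA; move: Ax; rewrite /= -{1}gA.
Qed.

(** * Ultrafilters containing a small set *)

Definition ultra_bounded (L : Type) (T : topologicalType) :=
  forall (A : set T) (F : set_system T),
    A #<= [set: L] -> UltraFilter F -> F A -> exists p : T, F --> p.

Lemma fmap_ultra (S T : Type) (f : S -> T) (F : set_system S) :
  UltraFilter F -> UltraFilter (f @ F).
Proof.
move=> FU; split=> [|G GF FG]; first exact: fmap_proper_filter.
apply/seteqP; split=> // A GA.
have [//|FnA] := in_ultra_setVsetC (f @^-1` A) FU.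
have GnA : G (~` A) by apply: FG.
by have [x []] := filter_ex (filterI GA GnA).
Qed.

Lemma cvg_prod (I : Type) (X : I -> topologicalType)
    (F : set_system (prod_topology X)) (p : prod_topology X) :
  Filter F -> (forall i, (fun x => x i) @ F --> p i) -> F --> p.
Proof.
move=> FF Fp; apply/cvg_sup => i N [_ [[V oV <-] Vp] VN].
apply: filterS VN _; apply: Fp.
exact: open_nbhs_nbhs.
Qed.

Lemma continuous_prod (I : Type) (S : topologicalType)
    (X : I -> topologicalType) (f : S -> prod_topology X) :
  (forall i, continuous (fun s => f s i)) -> continuous f.
Proof. by move=> fc s; apply: cvg_prod => i; exact: fc. Qed.

Lemma continuous_coordinate (I : Type) (X : I -> topologicalType) (i : I) :
  continuous (fun x : prod_topology X => x i).
Proof.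
move=> x; have /cvg_sup/(_ i) xi : x --> x by exact: cvg_id.
apply: cvg_trans (cvg_app _ xi) _.
exact: (@initial_continuous _ _ (fun x : prod_topology X => x i)).
Qed.

Lemma ultra_bounded_prod (L I : Type) (X : I -> topologicalType) :
  (forall i, ultra_bounded L (X i)) -> ultra_bounded L (prod_topology X).
Proof.
move=> Xb A F AL FU FA.
have coord_cvg i : {p : X i | (fun x => x i) @ F --> p}.
  apply/cid; apply: (Xb i ((fun x => x i) @` A)).
  - exact: card_le_trans (card_image_le _ _) AL.
  - exact: fmap_ultra.
  - by apply: (@filterS _ F _ A) => // x Ax; exists x.
exists (fun i => sval (coord_cvg i)); apply: cvg_prod => i.
exact: svalP (coord_cvg i).
Qed.

(** The classes P and Q are linked only through sections: a set W in P that a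
    finite subfamily misses is replaced by one nonempty section {y} * W_y.  This
    is what lets the argument serve arbitrary and open test sets alike. *)
Lemma compact_for_prod (L : Type) (Y Z : topologicalType)
    (P : set (set (Y * Z)%type)) (Q : set (set Z)) :
  infinite_set [set: L] -> ultra_bounded L Y -> compact_for L Q ->
  (forall W y, P W -> Q [set z | W (y, z)]) ->
  compact_for L P.
Proof.
move=> Linf Yb Zc PQ C [Copen Ccov CL]; apply: contrapT => nC.
pose J := [set D : set (set (Y * Z)) | finite_set D /\ D `<=` C].
have JL : J #<= [set: L] by exact: card_le_finite_subsets.
have J0 : J set0 by split.
have JU D E : J D -> J E -> J (D `|` E).
  move=> [Dfin DC] [Efin EC]; split; first by rewrite finite_setU.
  by move=> U [/DC|/EC].
have bad D : J D -> exists yW : Y * set Z,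
    [/\ Q yW.2, yW.2 !=set0 & forall z, yW.2 z -> ~ cover D id (yW.1, z)].
  move=> [Dfin DC]; apply: contrapT => nyW; apply: nC; exists D; split=> //.
  move=> W PW [[y z] Wyz]; apply: contrapT => WD; apply: nyW.
  exists (y, [set z | W (y, z)]); split=> /=; [exact: PQ|by exists z|].
  by move=> z' Wyz' Dyz'; apply: WD; exists (y, z').
have [yW0 _] := bad set0 J0.
have /choice[s sP] : forall D, exists yW : Y * set Z, J D ->
    [/\ Q yW.2, yW.2 !=set0 & forall z, yW.2 z -> ~ cover D id (yW.1, z)].
  by move=> D; have [/bad[yW ?]|] := pselect (J D); [exists yW|exists yW0].
pose tail D := \bigcup_(E in [set E | J E /\ D `<=` E]) (s E).2.
(* Otherwise the complements of the closures of the tails cover Z.  A finite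
   family of them, given by indices d V, misses (s D).2 for D the union of
   the d V, because (s D).2 lies in each of these tails. *)
have [z zP] : exists z, forall D, J D -> closure (tail D) z.
  apply: contrapT => nz.
  have [|E [EC Efin Emeet]] := Zc ((fun D => ~` closure (tail D)) @` J).
    split.
    - by move=> _ [D _ <-]; exact/closed_openC/closed_closure.
    - apply/seteqP; split=> // z _; apply: contrapT => nzJ; apply: nz; exists z.
      move=> D JD; apply: contrapT => nDz; apply: nzJ.
      by exists (~` closure (tail D)) => //; exists D.
    - exact: card_le_trans (card_image_le _ _) JL.
  have /choice[d dP] : forall V, exists D, E V -> J D /\ ~` closure (tail D) = V.
    move=> V; have [/EC[D JD DV]|] := pselect (E V); first by exists D.
    by exists set0.
  pose D := \bigcup_(V in E) d V.
  have JD : J D.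
    split; first by apply: bigcup_finite => // V /dP[[]].
    by move=> U [V /dP[[_ dVC] _] /dVC].
  have [QD D0 _] := sP D JD.
  have [x [sDx [V EV Vx]]] := Emeet _ QD D0.
  have [_ dV] := dP V EV; move: Vx; rewrite /= -{1}dV; apply.
  by apply: subset_closure; exists D => //; split=> // U dVU; exists V.
pose B (DN : set (set (Y * Z)) * set Z) :=
  [set y | exists E, [/\ J E, DN.1 `<=` E, (s E).1 = y & (s E).2 `&` DN.2 !=set0]].
pose F := filter_from [set DN | J DN.1 /\ nbhs z DN.2] B.
have FF : ProperFilter F.
  apply: filter_from_proper.
    apply: filter_from_filter.
      by exists (set0, setT); split=> //; exact: filterT.
    move=> [D N] [E M] [/= JD zN] [/= JE zM].
    exists (D `|` E, N `&` M); first by split; [exact: JU|exact: filterI].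
    by move=> y [G [JG /=]]; rewrite subUset => -[DG EG] Gy [w [Gw [Nw Mw]]];
      split; exists G; split=> //; exists w.
  move=> [D N] [/= JD zN]; have [w [[E [JE DE] Ew] Nw]] := zP D JD N zN.
  by exists (s E).1, E; split=> //; exists w.
(* G contains a set of at most |L| points, the first components of the s D. *)
have [G [GU FG]] := ultraFilterLemma FF.
have GA : G ((fun D => (s D).1) @` J).
  apply: FG; exists (set0, setT); first by split=> //; exact: filterT.
  by move=> y [E [JE _ <- _]]; exists E.
have [|y Gy] := Yb _ G _ GU GA.
  exact: card_le_trans (card_image_le _ _) JL.
have : cover C id (y, z) by rewrite Ccov.
move=> [U CU Uyz]; have := Copen U CU; rewrite openE => /(_ _ Uyz).
move=> [[V N] [/= yV zN] VNU].
have JU1 : J [set U] by split=> [|_ ->]; [exact: finite_set1|].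
have GB : G (B ([set U], N)) by apply: FG; exists ([set U], N).
have [y' [Vy' [E [JE /= UE Ey' [w [Ew Nw]]]]]] := filter_ex (filterI (Gy _ yV) GB).
have [_ _ /(_ w Ew)] := sP E JE; apply; exists U; first exact: UE.
by apply: VNU; split=> //=; rewrite Ey'.
Qed.

(** * Generalized ordered spaces *)

Lemma filter_bigcap_finite (T : Type) (I : choiceType) (D : set I)
    (f : I -> set T) (F : set_system T) :
  Filter F -> finite_set D -> (forall i, D i -> F (f i)) ->
  F (\bigcap_(i in D) f i).
Proof. by move=> FF /finite_fsetP[E ->] Ff; exact: filter_bigI. Qed.

(* Everything is stated for an arbitrary order with a base of convex sets, so
   that it applies to the reverse order as well.  The strict order y < x is
   written ~ le x y. *)
Section ordered.
Variables (T : topologicalType) (le : rel T) (B : set (set T)).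
Hypotheses (le_total : wochoice.total_order le) (T_T2 : hausdorff_space T).
Hypotheses (B_basis : basis B) (B_convex : B `<=` order_convex le).

Let lexx x : le x x. Proof. by have [[[]]] := le_total. Qed.
Let lexy x y : ~ le x y -> le y x.
Proof. by have [_ /(_ x y)/orP[|//]] := le_total. Qed.
Let le_trans x y z : le x y -> le y z -> le x z.
Proof. by have [[[_ tr] _] _] := le_total; exact: tr. Qed.

Let basis_at x N : nbhs x N -> exists2 U, B U /\ U x & U `<=` N.
Proof.
move=> xN; have [_ /(_ x N xN)] := B_basis.
by move=> [U BUx UN]; exists U.
Qed.

(** Hausdorff separation gives p < a a neighbourhood of p that misses a; a convex
    one cannot contain points beyond a. *)
Lemma open_lower_ray a : open [set x | ~ le a x].
Proof.
rewrite openE => p /= nap.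
have /eqP pa : p <> a by move=> pa; apply: nap; rewrite pa.
move: T_T2; rewrite open_hausdorff => /(_ p a pa)[[V W] /=].
rewrite !inE => -[Vp Wa] [oV oW VW].
have [U [BU Up] UV] := basis_at (open_nbhs_nbhs (conj oV Vp)).
have oU : open U by have [Bo _] := B_basis; exact: Bo.
apply: filterS (open_nbhs_nbhs (conj oU Up)) => x Ux ax.
have Ua : U a by apply: (B_convex BU Up Ux) => //; exact: lexy.
have : (V `&` W) a by split=> //; exact: UV.
by rewrite VW.
Qed.

(** Lo is the lower part of the cut of F, and F lives on Lo.  If F had no limit,
    the rays below the points of A `&` Lo, each enlarged by the complement of
    Lo, would be an open cover without a finite subfamily of dense union. *)
Lemma ultrafilter_above_cvg (L : Type) (A : set T) (F : set_system T) :
  (forall a, open [set x | ~ le x a]) ->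
  weakly_initially_compact L T -> A #<= [set: L] -> UltraFilter F -> F A ->
  F [set y | F [set x | ~ le x y]] -> exists p : T, F --> p.
Proof.
move=> open_upper Tc AL FU FA.
set Lo := [set y | F [set x | ~ le x y]] => FLo.
apply: contrapT => /forallNP nF.
have Lo_down x y : le x y -> Lo y -> Lo x.
  move=> xy; apply: filterS => z /= nzy zx; exact: nzy (le_trans zx xy).
have above y : Lo y -> exists x, [/\ A x, Lo x & ~ le x y].
  move=> Ly; have [x [[Ax Lx] nxy]] := filter_ex (filterI (filterI FA FLo) Ly).
  by exists x.
(* A point p of Hi in the closure of Lo is a limit: a convex neighbourhood of p
   contains some a in Lo, hence all of Lo above a. *)
have open_Hi : open (~` Lo).
  rewrite openE => p nLp; apply: contrapT => nint; apply: (nF p) => N pN.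
  have [U [BU Up] UN] := basis_at pN.
  have [a [Ua La]] : U `&` Lo !=set0.
    apply: contrapT => UL; apply: nint.
    have oU : open U by have [Bo _] := B_basis; exact: Bo.
    apply: filterS (open_nbhs_nbhs (conj oU Up)) => x Ux Lx.
    by apply: UL; exists x.
  apply: filterS (filterI La FLo) => x [/= nxa Lx]; apply: UN.
  apply: (B_convex BU Ua Up); first exact: lexy.
  by apply: lexy => px; exact: nLp (Lo_down _ _ px Lx).
have open_Lo : open Lo.
  rewrite openE => y Ly; have [x [_ Lx nxy]] := above y Ly.
  apply: filterS (open_nbhs_nbhs (conj (open_lower_ray x) nxy)) => z /= nxz.
  exact: Lo_down (lexy nxz) Lx.
pose C := (fun a => [set x | ~ le a x] `|` ~` Lo) @` (A `&` Lo).
have [|D [DC Dfin Ddense]] := Tc C.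
  split.
  - by move=> _ [a _ <-]; apply: openU => //; exact: open_lower_ray.
  - apply/seteqP; split=> // x _; have [Lx|nLx] := pselect (Lo x).
      have [a [Aa La nax]] := above x Lx.
      by exists ([set x | ~ le a x] `|` ~` Lo); [exists a|left].
    have [a [Aa La]] := filter_ex (filterI FA FLo).
    by exists ([set x | ~ le a x] `|` ~` Lo); [exists a|right].
  - apply: card_le_trans AL; apply: card_le_trans (card_image_le _ _) _.
    exact: subset_card_le.
(* F contains the complement of each member of C, so a finite subfamily misses
   some c in Lo; being a union of rays on Lo, it misses all of Lo above c. *)
have [c [Lc cD]] : Lo `&` ~` cover D id !=set0.
  suff FD : F (~` cover D id) by exact: (filter_ex (filterI FLo FD)).
  rewrite setC_bigcup; apply: filter_bigcap_finite => // _ /DC[a [_ La] <-].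
  apply: filterS (filterI La FLo) => x [/= nxa Lx] [/= nax|]; last exact.
  exact: nax (lexy nxa).
have [|x [[Lx /= nxc] [V DV Vx]]] :=
    Ddense (Lo `&` [set x | ~ le x c]) _ (openI open_Lo (open_upper c)).
  exact: filter_ex (filterI FLo Lc).
have [a _ aV] := DC V DV; move: Vx; rewrite /= -aV => -[/= nax|]; last exact.
apply: cD; exists V => //; rewrite /= -aV; left=> /= ac.
exact: nax (le_trans ac (lexy nxc)).
Qed.

End ordered.

Lemma total_order_rev (T : Type) (le : rel T) :
  wochoice.total_order le -> wochoice.total_order (fun x y => le y x).
Proof.
move=> [[[lexx le_trans] le_anti] le_total]; split=> [|x y]; last exact: le_total.
split; first by split=> // y x z yx zy; exact: le_trans zy yx.
by move=> x y; rewrite andbC => /le_anti.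
Qed.

Lemma GO_ultra_bounded (L : Type) (T : topologicalType) :
  GO_space T -> weakly_initially_compact L T -> ultra_bounded L T.
Proof.
move=> [le [le_total T2 [B B_basis B_convex]]] Tc A F AL FU FA.
have ge_total := total_order_rev le_total.
have B_convex' : B `<=` order_convex (fun x y => le y x).
  by move=> U /B_convex cU x y z Ux Uz yx zy; exact: (cU z y x).
have open_lower := open_lower_ray le_total T2 B_basis B_convex.
have open_upper := open_lower_ray ge_total T2 B_basis B_convex'.
have [FLo|FHi] := in_ultra_setVsetC [set y | F [set x | ~ le x y]] FU.
  exact: (ultrafilter_above_cvg le_total T2 B_basis B_convex open_upper Tc AL).
(* Unless F is principal, the upper part of the cut is, for the reverse order,
   the lower part. *)
have [[p Fp]|/forallNP nF] := pselect (exists p, F [set p]).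
  by exists p => N /nbhs_singleton Np; apply: filterS Fp => _ ->.
apply: (ultrafilter_above_cvg ge_total T2 B_basis B_convex' open_lower Tc AL) => //.
have [[[lexx _] le_anti] _] := le_total.
apply: filterS FHi => y /= nFy.
have [Fle|/nFy//] := in_ultra_setVsetC [set x | le x y] FU.
have [/nF//|Fny] := in_ultra_setVsetC [set y] FU.
apply: filterS (filterI Fle Fny) => x [/= xy nxy] yx; apply: nxy.
by apply: le_anti; rewrite xy.
Qed.

(** * Products *)

Section glue.
Variables (I : Type) (X : I -> topologicalType) (i0 : I).

(** The case of equal indices transports the second component along the equation,
    since the coordinates have dependent types. *)
Definition glue (yz : prod_topology (fun j : {i | i0 <> i} => X (sval j)) * X i0) :
    prod_topology X :=
  fun i => match pselect (i0 = i) with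
  | left e => eq_rect i0 X yz.2 i e
  | right ne => yz.1 (exist _ i ne)
  end.

Lemma glue_at yz : glue yz i0 = yz.2.
Proof. by rewrite /glue; case: pselect => // e; rewrite (Prop_irrelevance e erefl). Qed.

Lemma glue_surjective (x : prod_topology X) : exists yz, glue yz = x.
Proof.
exists ((fun j => x (sval j)), x i0); apply: functional_extensionality_dep => i.
by rewrite /glue; case: pselect => //= e; case: i / e.
Qed.

Lemma glue_continuous : continuous glue.
Proof.
apply: continuous_prod => i; rewrite /glue; case: pselect => [e|ne].
  by case: i / e => yz; exact: cvg_snd.
pose coord (y : prod_topology (fun j : {i | i0 <> i} => X (sval j))) :=
  y (exist _ i ne).
move=> yz; have fst_yz : {for yz, continuous fst} by exact: cvg_fst.
have coord_yz : {for yz.1, continuous coord}.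
  exact: (@continuous_coordinate _ (fun j : {i | i0 <> i} => X (sval j))).
exact: continuous_comp fst_yz coord_yz.
Qed.

End glue.

(** Both notions of compactness are instances: the class Q only has to contain the
    open sets, for the GO factors to be ultra-bounded, and be stable under
    continuous preimages, for images and sections. *)
Theorem compact_for_GO_prod (L I : Type) (X : I -> topologicalType)
    (Q : forall T : topologicalType, set (set T)) :
  infinite_set [set: L] -> (forall i, [set: X i] !=set0) ->
  is_subset1 [set i | ~ GO_space (X i)] ->
  (forall T : topologicalType, @open T `<=` Q T) ->
  (forall (S T : topologicalType) (f : S -> T) W,
     continuous f -> Q T W -> Q S (f @^-1` W)) ->
  compact_for L (Q (prod_topology X)) <-> forall i, compact_for L (Q (X i)).
Proof.
move=> Linf Xne XGO openQ Qpre; split=> [Pc i|Xc].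
  apply: compact_for_image Pc; [exact: (@continuous_coordinate _ X i)| |].
    pose y j := sval (cid (Xne (sval j))) : X (sval (j : {k | i <> k})).
    by move=> z; exists (glue (y, z)); exact: glue_at.
  by move=> W; apply: Qpre; exact: continuous_coordinate.
have Xb i : GO_space (X i) -> ultra_bounded L (X i).
  move=> /GO_ultra_bounded; apply; apply/weakly_initially_compactE.
  exact: compact_forS (openQ _) (Xc i).
have Pc (Y Z : topologicalType) : ultra_bounded L Y -> compact_for L (Q Z) ->
    compact_for L (Q (Y * Z)%type).
  move=> Yb Zc; apply: compact_for_prod Yb Zc _ => // W y.
  apply: (Qpre Z (Y * Z)%type (pair y)) => z.
  by apply: cvg_pair; [exact: cvg_cst|exact: cvg_id].
have [[i0 ni0]|allGO] := pselect (exists i, ~ GO_space (X i)).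
  apply: (compact_for_image (@glue_continuous _ X i0) (@glue_surjective _ X i0)).
    by move=> W; apply: Qpre; exact: glue_continuous.
  apply: Pc => //; apply: ultra_bounded_prod => -[i ne] /=; apply: Xb.
  by apply: contrapT => ni; apply: ne; exact: XGO.
have Xprod_b : ultra_bounded L (prod_topology X).
  apply: ultra_bounded_prod => i; apply: Xb; apply: contrapT => ni.
  by apply: allGO; exists i.
(* Every factor is GO: the two-point space stands in for the exceptional one,
   which also covers an empty family of factors. *)
have boolc : compact_for L (Q bool).
  move=> C [_ Ccov _].
  have /choice[c cP] : forall b : bool, exists U, C U /\ U b.
    by move=> b; have : cover C id b by [rewrite Ccov]; move=> [U CU Ub]; exists U.
  exists (c @` setT); split=> [_ [b _ <-]||W _ [b Wb]]; first by have [] := cP b.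
    exact/finite_image/finite_finset.
  by exists b; split=> //; exists (c b); [exists b|have [] := cP b].
apply: (@compact_for_image _ (prod_topology X * bool)%type _ fst) (Pc _ _ Xprod_b boolc).
- by move=> p; exact: cvg_fst.
- by move=> x; exists (x, true).
- by move=> W; apply: Qpre => p; exact: cvg_fst.
Qed.

Theorem corollary5p2 (L : Type) (L_infinite : infinite_set [set: L])
    (I : Type) (X : I -> topologicalType)
    (X_nonempty : forall i, [set: X i] !=set0)
    (X_GO : is_subset1 [set i | ~ GO_space (X i)]) :
  (initially_compact L (prod_topology X) <->
     forall i, initially_compact L (X i)) /\
  (weakly_initially_compact L (prod_topology X) <->
     forall i, weakly_initially_compact L (X i)).
Proof.
split.
  have [cP Pc] := compact_for_GO_prod (Q := fun T => setT) L_infinite X_nonempty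
    X_GO (fun _ _ _ => Logic.I) (fun _ _ _ _ _ _ => Logic.I).
  split=> [/initially_compactE/cP Xc i|Xc]; first exact/initially_compactE.
  by apply/initially_compactE/Pc => i; exact/initially_compactE.
have [|cP Pc] := compact_for_GO_prod (Q := @open) L_infinite X_nonempty X_GO
  (fun _ _ => id).
  by move=> S T f W /continuousP; exact.
split=> [/weakly_initially_compactE/cP Xc i|Xc].
  exact/weakly_initially_compactE.
by apply/weakly_initially_compactE/Pc => i; exact/weakly_initially_compactE.
Qed.
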